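(* If $(G,P,\theta)$ is an algebraic dynamical system for which $P$ is abelian, the subgroup $P^*$ of invertible elements of $P$ is finite, and $\bigcap_{p\in P}\theta_p(G)=\{1_G\}$, then the gauge action $\gamma\colon T\curvearrowright\mathcal{Q}(G\rtimes_\theta P)$ is an outer action.
   Context: An algebraic dynamical system is a triple $(G,P,\theta)$ where $G$ is a countable discrete group; $P$ is a right LCM semigroup, i.e. a countable left cancellative monoid in which the intersection of two principal right ideals is either empty or another principal right ideal; and $\theta$ is an action of $P$ on $G$ by injective group endomorphisms $\theta_p$ which respects the order: $pP\cap qP=rP$ implies $\theta_p(G)\cap\theta_q(G)=\theta_r(G)$. Write $N_p=[G:\theta_p(G)]$. An abelian $P$ is directed with respect to $p\geq q\Leftrightarrow p\in qP$. For directed $P$, the boundary quotient $\mathcal{Q}(G\rtimes_\theta P)$ is the universal $C^*$-algebra generated by a unitary representation $u$ of $G$ and a representation $s$ of the monoid $P$ by isometries satisfying (I) $s_pu_g=u_{\theta_p(g)}s_p$; (II) $s_p^*u_gs_q=u_{g_1}s_{p'}s_{q'}^*u_{g_2}$ if $g=\theta_p(g_1)\theta_q(g_2)$ and $pP\cap qP=pp'P$, $pp'=qq'$, and $s_p^*u_gs_q=0$ otherwise; (III) $\sum_{[g]\in G/\theta_p(G)}u_gs_ps_p^*u_g^*=1$ whenever $N_p<\infty$. $T$ is the Pontryagin dual of the Grothendieck group $P^{-1}P$ of the abelian monoid $P$, and the gauge action is $\gamma_\chi(u_gs_p)=\chi(p)u_gs_p$ for $\chi\in T$, $g\in G$, $p\in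 P$. An action is outer if every non-trivial group element acts by an automorphism that is not of the form ${\rm Ad}(w)$ for a unitary $w$ in the algebra. *)

(* Defs.v *)
From HB Require Import structures.
From mathcomp Require Import all_boot all_order all_algebra.
From mathcomp Require Import complex.
From mathcomp Require Import all_classical all_reals all_analysis.

Set Implicit Arguments.
Unset Strict Implicit.
Unset Printing Implicit Defensive.

Import Order.TTheory GRing.Theory Num.Theory.
Import numFieldNormedType.Exports.

Local Open Scope classical_set_scope.
Local Open Scope ring_scope.

Reserved Notation "x ** y" (at level 40, left associativity).

(* Unital C*-algebras, the zero algebra included. The norm takes its
   (nonnegative real) values in R[i], as for every normed module over R[i].
   The product is part of the mixin because the library's hierarchy does not
   admit a join of ring structures with normed modules. *)
HB.mixin Record NormedModule_isCStarAlgebra (R : realType) A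
    of CompleteNormedModule R[i] A := {
  cone : A ;
  cmul : A -> A -> A ;
  star : A -> A ;
  cmulA : associative cmul ;
  cmul1x : left_id cone cmul ;
  cmulx1 : right_id cone cmul ;
  cmulDl : left_distributive cmul +%R ;
  cmulDr : right_distributive cmul +%R ;
  cmulZl : forall (c : R[i]) (x y : A), cmul (c *: x) y = c *: cmul x y ;
  cmulZr : forall (c : R[i]) (x y : A), cmul x (c *: y) = c *: cmul x y ;
  starK : involutive star ;
  starD : {morph star : x y / x + y} ;
  starZ : forall (c : R[i]) (x : A), star (c *: x) = c^* *: star x ;
  starM : forall x y : A, star (cmul x y) = cmul (star y) (star x) ;
  norm_cmul : forall x y : A, `|cmul x y| <= `|x| * `|y| ;
  norm_star_cmul : forall x : A, `|cmul (star x) x| = `|x| ^+ 2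
}.

#[short(type="cstarAlgType")]
HB.structure Definition CStarAlgebra (R : realType) :=
  {A of CompleteNormedModule R[i] A & NormedModule_isCStarAlgebra R A}.

Arguments cone {R A} : rename.

Notation "x ** y" := (cmul x y) : ring_scope.

Section CStarAlgebras.
Variable R : realType.

Definition star_morphism (A B : cstarAlgType R) (f : A -> B) : Prop :=
  [/\ linear f, {morph f : x y / x ** y}, f cone = cone
    & {morph f : x / star x}].

Definition star_automorphism (A : cstarAlgType R) (f : A -> A) : Prop :=
  star_morphism f /\ bijective f.

Definition unitary (A : cstarAlgType R) (w : A) : Prop :=
  star w ** w = cone /\ w ** star w = cone.

Definition Ad (A : cstarAlgType R) (w x : A) : A := w ** x ** star w.

Definition star_subalgebra (A : cstarAlgType R) (S : set A) : Prop :=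
  [/\ S 0,
      forall (c : R[i]) (x y : A), S x -> S y -> S (c *: x + y),
      forall x y : A, S x -> S y -> S (x ** y)
    & forall x : A, S x -> S (star x)].

Definition action_by_automorphisms (H : groupType) (A : cstarAlgType R)
    (alpha : H -> A -> A) : Prop :=
  [/\ forall h, star_automorphism (alpha h),
      forall x, alpha 1%g x = x
    & forall h k x, alpha (h * k)%g x = alpha h (alpha k x)].

Definition outer (H : groupType) (A : cstarAlgType R)
    (alpha : H -> A -> A) : Prop :=
  forall h : H, h <> 1%g ->
    ~ exists w : A, unitary w /\ forall x, alpha h x = Ad w x.

End CStarAlgebras.

Section PontryaginDual.
Variables (R : realType) (K : groupType).

Definition is_character (chi : K -> R[i]) : Prop :=
  (forall k, `|chi k| = 1) /\ {morph chi : k l / (k * l)%g >-> k * l}.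

(* The Pontryagin dual of the discrete group K, as an abstract group. *)
Definition dual : Type := {chi : K -> R[i] | `[< is_character chi >]}.
HB.instance Definition _ := Choice.on dual.

Definition dual_fun (chi : dual) : K -> R[i] := sval chi.
Coercion dual_fun : dual >-> Funclass.

Lemma dualP (chi : dual) : is_character chi.
Proof. exact/asboolP/(svalP chi). Qed.

Lemma dual_eq (chi psi : dual) : (forall k, chi k = psi k) -> chi = psi.
Proof. by move=> e; apply/val_inj/funext. Qed.

Lemma dual1_subproof : `[< is_character (fun=> 1) >].
Proof. by apply/asboolP; split=> [k|k l]; rewrite ?normr1 ?mulr1. Qed.

Lemma dualM_subproof (chi psi : dual) :
  `[< is_character (fun k => chi k * psi k) >].
Proof.
apply/asboolP; have [n1 m1] := dualP chi; have [n2 m2] := dualP psi.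
split=> [k|k l]; first by rewrite normrM n1 n2 mulr1.
by rewrite m1 m2 mulrACA.
Qed.

Lemma dualV_subproof (chi : dual) : `[< is_character (fun k => (chi k)^-1) >].
Proof.
apply/asboolP; have [n1 m1] := dualP chi.
split=> [k|k l]; first by rewrite normfV n1 invr1.
by rewrite m1 invfM.
Qed.

Definition dual1 : dual :=
  exist (fun f => is_true `[< is_character f >]) _ dual1_subproof.
Definition dualM (chi psi : dual) : dual :=
  exist (fun f => is_true `[< is_character f >]) _ (dualM_subproof chi psi).
Definition dualV (chi : dual) : dual :=
  exist (fun f => is_true `[< is_character f >]) _ (dualV_subproof chi).

Lemma dual_mulA : associative dualM.
Proof. by move=> a b c; apply: dual_eq => k /=; rewrite /dual_fun/= mulrA. Qed.

Lemma dual_mul1 : left_id dual1 dualM.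
Proof. by move=> a; apply: dual_eq => k; rewrite /dual_fun/= mul1r. Qed.

Lemma dual_mulr1 : right_id dual1 dualM.
Proof. by move=> a; apply: dual_eq => k; rewrite /dual_fun/= mulr1. Qed.

Lemma dual_neq0 (a : dual) k : a k != 0.
Proof. by rewrite -normr_eq0 (dualP a).1 oner_eq0. Qed.

Lemma dual_mulV : left_inverse dual1 dualV dualM.
Proof.
move=> a; apply: dual_eq => k; rewrite /dual_fun/= mulVf //.
exact: dual_neq0.
Qed.

Lemma dual_mulrV : right_inverse dual1 dualV dualM.
Proof.
move=> a; apply: dual_eq => k; rewrite /dual_fun/= mulfV //.
exact: dual_neq0.
Qed.

HB.instance Definition _ :=
  isGroup.Build dual dual_mulA dual_mul1 dual_mulr1 dual_mulV dual_mulrV.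

End PontryaginDual.

Section Semigroups.
Variable P : monoidType.

Definition right_ideal (p : P) : set P := [set x | exists y, x = (p * y)%g].

Definition left_cancellative : Prop :=
  forall p q r : P, (p * q)%g = (p * r)%g -> q = r.

Definition right_LCM : Prop :=
  [/\ countable [set: P], left_cancellative
    & forall p q : P, right_ideal p `&` right_ideal q = set0 \/
        exists r, right_ideal p `&` right_ideal q = right_ideal r].

Definition abelian_monoid : Prop := forall p q : P, (p * q)%g = (q * p)%g.

Definition invertible_elements : set P :=
  [set p | exists q, (p * q)%g = 1%g /\ (q * p)%g = 1%g].

(* (K, i) is the group of fractions P^-1 P of the abelian monoid P. *)
Definition grothendieck_group (K : groupType) (i : P -> K) : Prop :=
  [/\ i 1%g = 1%g,
      {morph i : p q / (p * q)%g},
      forall k l : K, (k * l)%g = (l * k)%g,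
      forall k : K, exists p q : P, k = ((i p)^-1 * i q)%g
    & forall p q : P, i p = i q -> exists r, (r * p)%g = (r * q)%g].

End Semigroups.

Arguments invertible_elements P : clear implicits.

Section Systems.
Variables (G : groupType) (P : monoidType) (theta : P -> G -> G).

Record algebraic_dynamical_system : Prop := {
  ads_countable : countable [set: G] ;
  ads_right_LCM : right_LCM P ;
  ads_endo : forall p, {morph theta p : g h / (g * h)%g} ;
  ads_inj : forall p, injective (theta p) ;
  ads_act1 : forall g, theta 1%g g = g ;
  ads_actM : forall p q g, theta (p * q)%g g = theta p (theta q g) ;
  ads_order : forall p q r : P,
    right_ideal p `&` right_ideal q = right_ideal r ->
    range (theta p) `&` range (theta q) = range (theta r)
}.

Definition coset (p : P) (g : G) : set G :=
  [set h | exists k, h = (g * theta p k)%g].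

(* G / theta_p(G); its cardinality is N_p. *)
Definition cosets (p : P) : set (set G) := range (coset p).

(* The case distinction of relation (II). *)
Definition factorization (p q : P) (g g1 g2 : G) (p' q' : P) : Prop :=
  [/\ g = (theta p g1 * theta q g2)%g,
      right_ideal p `&` right_ideal q = right_ideal (p * p')%g
    & (p * p')%g = (q * q')%g].

Variable R : realType.

(* In (III), [xget 1%g c] is a representative of the coset c; by (I) the
   summand does not depend on the choice. *)
Record boundary_representation (A : cstarAlgType R) (u : G -> A) (s : P -> A)
    : Prop := {
  br_unitary : forall g, unitary (u g) ;
  br_u1 : u 1%g = cone ;
  br_uM : forall g h, u (g * h)%g = u g ** u h ;
  br_isometry : forall p, star (s p) ** s p = cone ;
  br_s1 : s 1%g = cone ;
  br_sM : forall p q, s (p * q)%g = s p ** s q ;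
  br_I : forall p g, s p ** u g = u (theta p g) ** s p ;
  br_II : forall p q g g1 g2 p' q', factorization p q g g1 g2 p' q' ->
    star (s p) ** u g ** s q = u g1 ** s p' ** star (s q') ** u g2 ;
  br_II0 : forall p q g,
    ~ (exists g1 g2 p' q', factorization p q g g1 g2 p' q') ->
    star (s p) ** u g ** s q = 0 ;
  br_III : forall p, finite_set (cosets p) ->
    \sum_(c \in cosets p)
      (let g := xget 1%g c in u g ** s p ** star (s p) ** star (u g)) = cone
}.

(* (Q, u, s) is the universal C*-algebra generated by a representation of the
   relations; this determines it up to a unique isomorphism. *)
Record boundary_quotient (Q : cstarAlgType R) (u : G -> Q) (s : P -> Q)
    : Prop := {
  bq_representation : boundary_representation u s ;
  bq_generated : forall S : set Q, closed S -> star_subalgebra S ->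
    (forall g, S (u g)) -> (forall p, S (s p)) -> S = setT ;
  bq_universal : forall (B : cstarAlgType R) (v : G -> B) (t : P -> B),
    boundary_representation v t ->
    exists phi : Q -> B, [/\ star_morphism phi,
      forall g, phi (u g) = v g & forall p, phi (s p) = t p]
}.

Definition gauge_action (K : groupType) (i : P -> K)
    (Q : cstarAlgType R) (u : G -> Q) (s : P -> Q)
    (gamma : dual R K -> Q -> Q) : Prop :=
  action_by_automorphisms gamma /\
  forall (chi : dual R K) (g : G) (p : P),
    gamma chi (u g ** s p) = chi (i p) *: (u g ** s p).

End Systems.

(* Main.v *)
Require Import Defs.
From HB Require Import structures.
From mathcomp Require Import all_boot all_order all_algebra.
From mathcomp Require Import complex finmap.
From mathcomp Require Import all_classical all_reals all_analysis.
From mathcomp Require Import ring.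

(** If [gamma chi] were [Ad w] for a unitary [w] of the boundary quotient, then
    [w s_p = chi(p) s_p w] for all [p]. This is tested in one concrete
    representation, on the Hilbert space l2(G) with orthonormal basis
    [delta x], [x] in [G]: the group acts by left translation,
    [u_g (delta x) = delta (g x)], and [s_p (delta x) = delta (theta_p x)].
    [regular_representation] checks the relations. In the summation
    relation, the term of the coset [g theta_p(G)] is the projection onto the
    functions supported on that coset, and the cosets partition [G]. For the
    products [s_p^* u_g s_q], [P] abelian makes any two principal right ideals
    meet, and the condition that [theta] respects the order says when
    [theta_p(x) = g theta_q(y)] can be solved.

    Let [W] be the image of [w] and [xi = W (delta 1)]. Since
    [s_p (delta 1) = delta 1], the commutation relation gives
    [xi = chi(p) s_p xi] for every [p]. Thus [xi] vanishes off every
    [theta_p(G)], hence off [{1}], so that [xi] is a multiple of [delta 1];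
    it is nonzero because [W] is isometric. Comparing the values at [1] of the
    two sides of [xi = chi(p) s_p xi] gives [chi(p) = 1]. This is
    [isometry_scaling_trivial], and a character that is trivial on [P] is
    trivial on the group of fractions ([dual_trivial]).

    The universal property of the quotient speaks only of C*-algebras, so most
    of the work is to exhibit the bounded operators on l2(G) as one. Inner
    products and the Cauchy-Schwarz inequality come first, then l2(X) as a
    Hilbert space, whose inner product is an unconditional sum that converges
    by polarization, and then the bounded adjointable operators on any Hilbert
    space, with the operator norm. Completeness is in each case the usual
    argument: a Cauchy filter converges coordinatewise (or pointwise), and the
    limit stays uniformly close to the filter. *)

Set Implicit Arguments.
Unset Strict Implicit.
Unset Printing Implicit Defensive.
Import Order.TTheory GRing.Theory Num.Theory.
Import numFieldNormedType.Exports.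
Local Open Scope classical_set_scope.
Local Open Scope ring_scope.

(** * Inner products *)

Record inner_product (C : numClosedFieldType) (V : lmodType C)
    (ip : V -> V -> C) : Prop := {
  ip_linearl : forall a x y z, ip (a *: x + y) z = a * ip x z + ip y z ;
  ip_conj : forall x y, ip y x = (ip x y)^* ;
  ip_ge0 : forall x, 0 <= ip x x ;
  ip_definite : forall x, ip x x = 0 -> x = 0
}.

Section InnerProducts.
Variables (C : numClosedFieldType) (V : lmodType C) (ip : V -> V -> C).
Hypothesis ipP : inner_product ip.

Lemma ipDl x y z : ip (x + y) z = ip x z + ip y z.
Proof. by have := ip_linearl ipP 1 x y z; rewrite scale1r mul1r. Qed.

Lemma ip0l z : ip 0 z = 0.
Proof. by apply: (addrI (ip 0 z)); rewrite -ipDl !addr0. Qed.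

Lemma ipZl a x z : ip (a *: x) z = a * ip x z.
Proof. by have := ip_linearl ipP a x 0 z; rewrite ip0l !addr0. Qed.

Lemma ipNl x z : ip (- x) z = - ip x z.
Proof. by rewrite -scaleN1r ipZl mulN1r. Qed.

Lemma ipBl x y z : ip (x - y) z = ip x z - ip y z.
Proof. by rewrite ipDl ipNl. Qed.

Lemma ipDr x y z : ip z (x + y) = ip z x + ip z y.
Proof. by rewrite !(ip_conj ipP _ z) ipDl rmorphD. Qed.

Lemma ip0r z : ip z 0 = 0.
Proof. by rewrite (ip_conj ipP) ip0l rmorph0. Qed.

Lemma ipZr a x z : ip z (a *: x) = a^* * ip z x.
Proof. by rewrite !(ip_conj ipP _ z) ipZl rmorphM. Qed.

Lemma ipBr x y z : ip z (x - y) = ip z x - ip z y.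
Proof. by rewrite !(ip_conj ipP _ z) ipBl rmorphB. Qed.

Lemma ip_ext x y : (forall z, ip x z = ip y z) -> x = y.
Proof.
move=> xy; apply/subr0_eq/(ip_definite ipP).
by rewrite ipBl xy subrr.
Qed.

Lemma ip_sym_ext x y : (forall z, ip z x = ip z y) -> x = y.
Proof.
by move=> xy; apply: ip_ext => z; rewrite !(ip_conj ipP z) xy.
Qed.

Lemma cauchy_schwarz x y : `|ip x y| ^+ 2 <= ip x x * ip y y.
Proof.
have [->|y0] := eqVneq y 0; first by rewrite !ip0r normr0 expr0n mulr0.
have yy : 0 < ip y y.
  rewrite lt_def (ip_ge0 ipP) andbT.
  by apply/eqP => /(ip_definite ipP)/eqP; exact/negP.
(* Positivity at <y, y> x - <x, y> y, a multiple of the component of [x]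
   orthogonal to [y]. *)
have := ip_ge0 ipP (ip y y *: x - ip x y *: y).
rewrite ipBl !ipBr !ipZl !ipZr (ip_conj ipP x y) (CrealP (gtr0_real yy)).
rewrite [X in _ - _ - X](_ : _ = 0); last by ring.
rewrite subr0 -mulrBr pmulr_rge0// subr_ge0 mulrC -normCK.
by rewrite [leRHS]mulrC.
Qed.

Lemma cauchy_schwarz_sqrt x y : `|ip x y| <= sqrtC (ip x x) * sqrtC (ip y y).
Proof.
rewrite -(@ler_pXn2r _ 2) ?nnegrE ?mulr_ge0 ?sqrtC_ge0 ?ip_ge0//.
by rewrite exprMn !sqrtCK cauchy_schwarz.
Qed.

Lemma ip_triangle x y :
  sqrtC (ip (x + y) (x + y)) <= sqrtC (ip x x) + sqrtC (ip y y).
Proof.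
rewrite -(@ler_pXn2r _ 2) ?nnegrE ?addr_ge0 ?sqrtC_ge0 ?ip_ge0//.
rewrite sqrrD !sqrtCK ipDl !ipDr (ip_conj ipP x y).
have -> : ip x x + ip x y + ((ip x y)^* + ip y y) =
    ip x x + (ip x y + (ip x y)^*) + ip y y by ring.
rewrite lerD2r lerD2l.
have -> : ip x y + (ip x y)^* = 'Re (ip x y) *+ 2.
  by rewrite ReE -mulr_natr divfK ?pnatr_eq0.
rewrite lerMn2r/= (le_trans _ (cauchy_schwarz_sqrt x y))//.
by case: (leif_Re_Creal (ip x y)).
Qed.
End InnerProducts.

(** Hilbert spaces are complete normed modules whose norm comes from an inner
    product. *)
HB.mixin Record NormedModule_isHilbert (R : realType) H
    of CompleteNormedModule R[i] H := {
  ip : H -> H -> R[i] ;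
  ip_inner : @inner_product R[i] H ip ;
  ip_norm : forall x : H, ip x x = `|x| ^+ 2
}.

#[short(type="hilbertType")]
HB.structure Definition Hilbert (R : realType) :=
  {H of CompleteNormedModule R[i] H & NormedModule_isHilbert R H}.

(** * Unconditional sums *)

Section UnconditionalSums.
Variables (R : realType) (X : choiceType).
Implicit Types (a b : X -> R[i]) (l m : R[i]) (A B : {fset X}).

Definition fsum a A : R[i] := \sum_(x <- A) a x.

(** Convergence of the net of finite partial sums, ordered by inclusion. *)
Definition has_sum a l : Prop := forall e : R[i], 0 < e ->
  exists A, forall B, (A `<=` B)%fset -> `|l - fsum a B| < e.

Definition infsum a : R[i] := xget 0 [set l | has_sum a l].

Lemma has_sum_unique a l m : has_sum a l -> has_sum a m -> l = m.
Proof.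
move=> al am; apply/subr0_eq/normr0_eq0/le_anti; rewrite normr_ge0 andbT.
apply/ler_addgt0Pr => e e0; rewrite add0r.
have e2 : 0 < e / 2 by rewrite divr_gt0.
have [A lA] := al _ e2; have [B mB] := am _ e2.
have -> : l - m = (l - fsum a (A `|` B)%fset) - (m - fsum a (A `|` B)%fset).
  by ring.
rewrite (le_trans (ler_normB _ _))// [e]splitr.
by rewrite lerD ?ltW ?lA ?mB ?fsubsetUl ?fsubsetUr.
Qed.

Lemma infsumE a l : has_sum a l -> infsum a = l.
Proof.
move=> al; rewrite /infsum; case: xgetP => [m _ am|/(_ l)]//.
exact: has_sum_unique al.
Qed.

Lemma fsumD a b A : fsum (fun x => a x + b x) A = fsum a A + fsum b A.
Proof. exact: big_split. Qed.

Lemma fsumZ c a A : fsum (fun x => c * a x) A = c * fsum a A.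
Proof. by rewrite /fsum -mulr_sumr. Qed.

Lemma has_sumD a b l m : has_sum a l -> has_sum b m ->
  has_sum (fun x => a x + b x) (l + m).
Proof.
move=> al bm e e0; have e2 : 0 < e / 2 by rewrite divr_gt0.
have [A lA] := al _ e2; have [B mB] := bm _ e2.
exists (A `|` B)%fset => D /fsubUsetP[AD BD].
rewrite fsumD opprD addrACA (le_lt_trans (ler_normD _ _))// [e]splitr.
by rewrite ltrD ?lA ?mB.
Qed.

Lemma has_sumZ c a l : has_sum a l -> has_sum (fun x => c * a x) (c * l).
Proof.
move=> al e e0; have ec : 0 < e / (`|c| + 1).
  by rewrite divr_gt0// ltr_wpDl.
have [A lA] := al _ ec; exists A => B /lA.
rewrite fsumZ -mulrBr normrM ltr_pdivlMr ?ltr_wpDl//; apply: le_lt_trans.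
by rewrite mulrC ler_wpM2l// lerDl.
Qed.

Lemma has_sum_conj a l : has_sum a l -> has_sum (fun x => (a x)^*) l^*.
Proof.
move=> al e /al[A lA]; exists A => B /lA.
by rewrite /fsum -rmorph_sum -rmorphB norm_conjC.
Qed.

Lemma fsum_le a A B : (forall x, 0 <= a x) -> (A `<=` B)%fset ->
  fsum a A <= fsum a B.
Proof.
move=> a0 AB; rewrite /fsum [leRHS](big_fsetID _ (mem A))/=.
have -> : [fset x in B | x \in A]%fset = A.
  apply/fsetP => x; rewrite !inE/=.
  by have [xA|] := boolP (x \in A); rewrite ?andbF// (fsubsetP AB).
by rewrite lerDl sumr_ge0.
Qed.

(** For nonnegative terms the partial sums are monotone, so their least upper
    bound is the sum. *)
Lemma ge0_has_sum a M : (forall x, 0 <= a x) -> (forall A, fsum a A <= M) ->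
  exists l, [/\ has_sum a l, forall A, fsum a A <= l
    & forall N, (forall A, fsum a A <= N) -> l <= N].
Proof.
move=> a0 aM; pose S := [set complex.Re (fsum a A) | A in [set: {fset X}]].
have fsumE A : fsum a A = (complex.Re (fsum a A))%:C%C.
  by rewrite RRe_real// ger0_real// sumr_ge0.
have fsum_leRe A N : fsum a A <= N -> complex.Re (fsum a A) <= complex.Re N.
  by rewrite lecE => /andP[].
have S_sup : has_sup S.
  split; first by exists (complex.Re (fsum a fset0)), fset0.
  by exists (complex.Re M) => _ [A _ <-]; exact: fsum_leRe.
have a_le A : fsum a A <= (sup S)%:C%C.
  rewrite fsumE lecR; apply: (ub_le_sup S_sup.2); by exists A.
exists (sup S)%:C%C; split=> // [e e0|N aN]; last first.
  have N_real : N = (complex.Re N)%:C%C.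
    by rewrite RRe_real// ger0_real// (le_trans _ (aN fset0))// sumr_ge0.
  rewrite N_real lecR; apply: ge_sup; first exact: S_sup.1.
  by move=> _ [A _ <-]; exact: fsum_leRe.
have e_real : e = (complex.Re e)%:C%C by rewrite RRe_real// gtr0_real.
have e0' : 0 < complex.Re e by rewrite -ltcR -e_real.
have [_ [A _ <-] Ae] := sup_adherent e0' S_sup.
exists A => B AB; rewrite ger0_norm ?subr_ge0//.
rewrite ltrBlDr -ltrBlDl (lt_le_trans _ (fsum_le a0 AB))//.
by rewrite e_real -rmorphB fsumE ltcR.
Qed.

End UnconditionalSums.

(** * Completeness of the complex numbers *)

Section ComplexCompleteness.
Variable R : realType.
Implicit Types z : R[i].

Lemma norm_le_Re_Im z :
  `|z| <= (`|complex.Re z| + `|complex.Im z|)%:C%C.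
Proof.
have norm_re (r : R) : `|r%:C%C| = `|r|%:C%C.
  by rewrite normc_def/= expr0n addr0 sqrtr_sqr.
rewrite {1}(complexE z) (le_trans (ler_normD _ _))//.
by rewrite rmorphD/= normrM !norm_re complexiE normCi mul1r.
Qed.

Lemma norm_ge_Im z : `|complex.Im z|%:C%C <= `|z|.
Proof.
have := normc_ge_Re ('i * z); rewrite normrM normCi mul1r; apply: le_trans.
by rewrite -complexiE; case: z => a b /=; rewrite mul0r mul1r sub0r normrN.
Qed.

Lemma complex_complete (F : set_system R[i]^o) :
  ProperFilter F -> cauchy F -> cvg F.
Proof.
move=> FF /cauchyP Fc.
have part_cvg (f : R[i]^o -> R) : (forall z w, f (z - w) = f z - f w) ->
    (forall z, `|f z|%:C%C <= `|z|) -> cvg (f @ F).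
  move=> fB fle; apply/cauchy_cvgP/cauchyP => e e0.
  have e0' : 0 < e%:C%C by rewrite ltcR.
  have [z Fz] := Fc _ e0'; exists (f z).
  rewrite /fmap/=; apply: filterS Fz => w.
  rewrite /ball/= -fB -ltcR; exact: le_lt_trans.
have re_cvg : cvg ((@complex.Re R : R[i]^o -> R) @ F).
  by apply: part_cvg => [[a b] [c d]//|z]; exact: normc_ge_Re.
have im_cvg : cvg ((@complex.Im R : R[i]^o -> R) @ F).
  by apply: part_cvg => [[a b] [c d]//|z]; exact: norm_ge_Im.
move: re_cvg im_cvg => /cvg_ex[a /cvgrPdist_lt Fa] /cvg_ex[b /cvgrPdist_lt Fb].
apply/cvg_ex; exists (Complex a b); apply/cvgrPdist_lt => e e0.
have e_real : e = (complex.Re e)%:C%C by rewrite RRe_real// gtr0_real.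
have e2 : 0 < complex.Re e / 2 by rewrite divr_gt0// -ltcR -e_real.
apply: filterS2 (Fa _ e2) (Fb _ e2) => z az bz.
apply: (le_lt_trans (norm_le_Re_Im _)).
rewrite e_real ltcR [ltRHS]splitr; case: z az bz => c d /= az bz.
by rewrite ltrD.
Qed.

End ComplexCompleteness.

(** * The Hilbert space of square-summable functions *)

Lemma sqr_normD_le (K : numFieldType) (a b : K) :
  `|a + b| ^+ 2 <= 2 * (`|a| ^+ 2 + `|b| ^+ 2).
Proof.
rewrite (@le_trans _ _ ((`|a| + `|b|) ^+ 2))//.
  by rewrite ler_pXn2r ?nnegrE ?addr_ge0// ler_normD.
rewrite -subr_ge0.
have -> : 2 * (`|a| ^+ 2 + `|b| ^+ 2) - (`|a| + `|b|) ^+ 2 = (`|a| - `|b|) ^+ 2.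
  by ring.
by rewrite -realEsqr rpredB// normr_real.
Qed.

Lemma sqr_muln_le (K : numFieldType) (d : K) n : 0 <= d ->
  d ^+ 2 *+ n <= (d * n.+1%:R) ^+ 2.
Proof.
move=> d0; rewrite -mulr_natr exprMn ler_wpM2l ?exprn_ge0// -natrX ler_nat.
by rewrite (leq_trans (leqnSn _))// expnS expn1 leq_pmulr.
Qed.

Section SquareSummable.
Variables (R : realType) (X : choiceType).
Implicit Types (A : {fset X}).

Definition square_summable : {pred X -> R[i]^o} := fun f =>
  `[< exists M, forall A, fsum (fun x => `|f x| ^+ 2) A <= M >].

Lemma square_summableP (f : X -> R[i]^o) :
  reflect (exists M, forall A, fsum (fun x => `|f x| ^+ 2) A <= M)
    (f \in square_summable).
Proof. exact: asboolP. Qed.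

Lemma square_summable_submod : submod_closed square_summable.
Proof.
split=> [|c f g /square_summableP[M fM] /square_summableP[N gN]].
  apply/square_summableP; exists 0 => A.
  by rewrite /fsum big1// => x _; rewrite normr0 expr0n.
apply/square_summableP; exists (2 * (`|c| ^+ 2 * M + N)) => A.
rewrite (@le_trans _ _ (fsum (fun x => 2 *
    (`|c| ^+ 2 * `|f x| ^+ 2 + `|g x| ^+ 2)) A))//.
  apply: ler_sum => x _; rewrite -exprMn -normrM.
  exact: sqr_normD_le.
by rewrite fsumZ fsumD fsumZ ler_pM2l// lerD// ler_wpM2l ?exprn_ge0.
Qed.

HB.instance Definition _ :=
  GRing.isSubmodClosed.Build R[i] (X -> R[i]^o) square_summable
    square_summable_submod.

Definition l2 : Type := {f : X -> R[i]^o | f \in square_summable}.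
HB.instance Definition _ := SubChoice.on l2.
HB.instance Definition _ := [SubChoice_isSubLmodule of l2 by <:].

Definition l2_fun (f : l2) : X -> R[i] := val f.
Coercion l2_fun : l2 >-> Funclass.

Definition mk_l2 (f : X -> R[i]^o) (fP : f \in square_summable) : l2 :=
  exist (fun f => f \in square_summable) f fP.

Implicit Types (f g h : l2).

Lemma l2_ext f g : (forall x, f x = g x) -> f = g.
Proof. by move=> fg; apply/val_inj/funext. Qed.

Lemma l2DE f g x : (f + g : l2) x = f x + g x.
Proof. by []. Qed.

Lemma l2ZE (c : R[i]) f x : (c *: f : l2) x = c * f x.
Proof. by []. Qed.

Lemma l2NE f x : (- f : l2) x = - f x.
Proof. by []. Qed.

Lemma l20E x : (0 : l2) x = 0.
Proof. by []. Qed.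

(** Expresses [f x * (g x)^*] by squared moduli of functions of l2, so that
    the inner product converges because sums of bounded nonnegative terms
    do. *)
Lemma polarization (C : numClosedFieldType) (a b : C) :
  a * b^* = 4^-1 * (`|a + b| ^+ 2 + (-1) * `|a - b| ^+ 2 +
    ('i * `|a + 'i * b| ^+ 2 + (- 'i) * `|a - 'i * b| ^+ 2)).
Proof.
rewrite !normCK !rmorphD !rmorphN !rmorphM /= conjCi.
have ii : 'i * 'i = -1 :> C by rewrite -expr2 sqrCi.
set a' := a^*; set b' := b^*.
have -> : 'i * ((a + 'i * b) * (a' + - 'i * b')) =
  'i * (a * a' - 'i * 'i * b * b') + 'i * 'i * (b * a' - a * b') by ring.
have -> : - 'i * ((a - 'i * b) * (a' - - 'i * b')) =
  - 'i * (a * a' - 'i * 'i * b * b') + 'i * 'i * (b * a' - a * b') by ring.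
by rewrite ii; field.
Qed.

Lemma l2_sqr_has_sum f : exists l, [/\ has_sum (fun x => `|f x| ^+ 2) l,
  forall A, fsum (fun x => `|f x| ^+ 2) A <= l
  & forall N, (forall A, fsum (fun x => `|f x| ^+ 2) A <= N) -> l <= N].
Proof.
have /square_summableP[M fM] := valP f.
by apply: (ge0_has_sum _ fM) => x; rewrite exprn_ge0.
Qed.

Definition l2_ip f g : R[i] := infsum (fun x => f x * (g x)^*).

Lemma l2_ip_has_sum f g : has_sum (fun x => f x * (g x)^*) (l2_ip f g).
Proof.
suff [l fgl] : exists l, has_sum (fun x => f x * (g x)^*) l.
  by rewrite /l2_ip (infsumE fgl).
have [l1 [s1 _ _]] := l2_sqr_has_sum (f + g).
have [l2 [s2 _ _]] := l2_sqr_has_sum (f - g).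
have [l3 [s3 _ _]] := l2_sqr_has_sum (f + 'i *: g).
have [l4 [s4 _ _]] := l2_sqr_has_sum (f - 'i *: g).
exists (4^-1 * (l1 + (-1) * l2 + ('i * l3 + (- 'i) * l4))).
have := has_sumZ 4^-1 (has_sumD (has_sumD s1 (has_sumZ (-1) s2))
  (has_sumD (has_sumZ 'i s3) (has_sumZ (- 'i) s4))).
by congr (has_sum _ _); apply/funext => x; rewrite polarization.
Qed.

Lemma l2_ip_sqr f : (forall A, fsum (fun x => `|f x| ^+ 2) A <= l2_ip f f) /\
  forall N, (forall A, fsum (fun x => `|f x| ^+ 2) A <= N) -> l2_ip f f <= N.
Proof.
have [l [fl le_l l_le]] := l2_sqr_has_sum f.
suff -> : l2_ip f f = l by [].
by rewrite -(infsumE fl); congr infsum; apply/funext => x; rewrite normCK.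
Qed.

Lemma l2_ip_linearl (a : R[i]) f g h :
  l2_ip (a *: f + g) h = a * l2_ip f h + l2_ip g h.
Proof.
have lin := has_sumD (has_sumZ a (l2_ip_has_sum f h)) (l2_ip_has_sum g h).
apply: infsumE; rewrite (_ : (fun _ => _) =
    fun x => a * (f x * (h x)^*) + g x * (h x)^*)//.
by apply/funext => x; rewrite l2DE l2ZE mulrDl mulrA.
Qed.

Lemma l2_ip_conj f g : l2_ip g f = (l2_ip f g)^*.
Proof.
apply: infsumE; rewrite (_ : (fun _ => _) = fun x => (f x * (g x)^*)^*).
  exact/has_sum_conj/l2_ip_has_sum.
by apply/funext => x; rewrite rmorphM/= conjCK mulrC.
Qed.

Lemma l2_ip_ge0 f : 0 <= l2_ip f f.
Proof.
by have [/(_ fset0) + _] := l2_ip_sqr f; rewrite /fsum big_seq_fset0.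
Qed.

Lemma l2_le_ip f x : `|f x| ^+ 2 <= l2_ip f f.
Proof.
by have [/(_ [fset x]%fset) + _] := l2_ip_sqr f; rewrite /fsum big_seq_fset1.
Qed.

Lemma l2_ip_definite f : l2_ip f f = 0 -> f = 0.
Proof.
move=> f0; apply: l2_ext => x; rewrite l20E; apply/eqP.
by rewrite -normr_eq0 -sqrf_eq0 eq_le exprn_ge0// andbT -f0 l2_le_ip.
Qed.

Lemma l2_ip_inner : @inner_product R[i] l2 l2_ip.
Proof.
by split; [exact: l2_ip_linearl|exact: l2_ip_conj|exact: l2_ip_ge0|
  exact: l2_ip_definite].
Qed.

Definition l2_norm f : R[i] := sqrtC (l2_ip f f).

Lemma l2_normD f g : l2_norm (f + g) <= l2_norm f + l2_norm g.
Proof. exact: (ip_triangle l2_ip_inner). Qed.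

Lemma l2_normZ (a : R[i]) f : l2_norm (a *: f) = `|a| * l2_norm f.
Proof.
rewrite /l2_norm (ipZl l2_ip_inner) (ipZr l2_ip_inner) mulrA -normCK.
by rewrite rootCMl ?exprn_ge0// sqrCK.
Qed.

Lemma l2_norm0_eq0 f : l2_norm f = 0 -> f = 0.
Proof. by move=> /eqP; rewrite sqrtC_eq0 => /eqP/l2_ip_definite. Qed.

HB.instance Definition _ :=
  Lmodule_isNormed.Build R[i] l2 l2_normD l2_normZ l2_norm0_eq0.

Lemma l2_normE f : `|f| = sqrtC (l2_ip f f).
Proof. by []. Qed.

Lemma l2_norm_sqr f : l2_ip f f = `|f| ^+ 2.
Proof. by rewrite l2_normE sqrtCK. Qed.

(** The norm is a supremum over finite subsets, which lets estimates pass to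
    coordinatewise limits. *)
Lemma l2_norm_le f (M : R[i]) : 0 <= M ->
  (`|f| <= M) <-> forall A, fsum (fun x => `|f x| ^+ 2) A <= M ^+ 2.
Proof.
move=> M0; have [le_f f_le] := l2_ip_sqr f.
have -> : (`|f| <= M) = (l2_ip f f <= M ^+ 2).
  by rewrite l2_norm_sqr ler_pXn2r ?nnegrE.
by split=> [fM A|/f_le//]; rewrite (le_trans (le_f A)).
Qed.

Lemma l2_coord_le f x : `|f x| <= `|f|.
Proof. by rewrite -(@ler_pXn2r _ 2) ?nnegrE// -l2_norm_sqr l2_le_ip. Qed.

(** The limit [L] is taken coordinatewise. On a finite set [A] a member of the
    filter can be chosen close to [L] at every point of [A], which bounds the
    distance from [L] on [A] uniformly in [A]. *)
Lemma l2_complete (F : set_system l2) : ProperFilter F -> cauchy F -> cvg F.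
Proof.
move=> FF /cauchyP Fc.
have Fx e : 0 < e -> exists f : l2, F (ball f e) by exact: Fc.
have coord_cvg x : cvg ((fun f : l2 => f x : R[i]^o) @ F).
  apply: complex_complete; apply/cauchyP => e e0; have [f Ff] := Fx _ e0.
  exists (f x); rewrite /fmap/=; apply: (filterS _ Ff) => g.
  rewrite -ball_normE/= => fg; rewrite /ball/=.
  exact: le_lt_trans (l2_coord_le (f - g) x) fg.
pose L x : R[i]^o := lim ((fun f : l2 => f x : R[i]^o) @ F).
have dist_L (f : l2) e : 0 < e -> F (ball f e) -> forall A,
    fsum (fun x => `|f x - L x| ^+ 2) A <= (2 * e) ^+ 2.
  (* With this [d], the error [d ^+ 2] summed over [A] is at most [e ^+ 2]. *)
  move=> e0 Ff A; pose d := e / (#|` A|.+1%:R).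
  have d0 : 0 < d by rewrite divr_gt0.
  have /(@filter_ex _ F FF)[g [fg gL]] : F (ball f e `&`
      \bigcap_(x in [set` A]) [set g : l2 | `|L x - g x| < d]).
    apply: filterI => //; apply: filter_bigI => x _.
    by have /cvgrPdist_lt/(_ _ d0) := coord_cvg x.
  move: fg; rewrite -ball_normE/= => /ltW fg.
  rewrite (@le_trans _ _ (2 * (e ^+ 2 + e ^+ 2)))//; last first.
    by rewrite le_eqVlt; apply/orP; left; apply/eqP; ring.
  rewrite (@le_trans _ _ (fsum (fun x => 2 * (`|(f - g : l2) x| ^+ 2
      + `|g x - L x| ^+ 2)) A))//.
    apply: ler_sum => x _.
    have -> : f x - L x = (f x - g x) + (g x - L x) by ring.
    exact: sqr_normD_le.
  rewrite fsumZ fsumD ler_pM2l// lerD//.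
    exact: (l2_norm_le (f - g) (ltW e0)).1.
  rewrite (@le_trans _ _ (fsum (fun=> d ^+ 2) A))//.
    rewrite /fsum big_seq [leRHS]big_seq; apply: ler_sum => x xA.
    by rewrite ler_pXn2r ?nnegrE ?(ltW d0)// distrC ltW//; apply: gL.
  rewrite /fsum big_const_seq count_predT iter_addr_0.
  have -> : e = d * #|` A|.+1%:R by rewrite divfK// pnatr_eq0.
  exact/sqr_muln_le/ltW.
(* [L] is square-summable because it differs from [f1] by such a function. *)
have [f1 Ff1] := Fx _ ltr01.
have gP : (fun x => f1 x - L x) \in square_summable.
  by apply/square_summableP; exists ((2 * 1) ^+ 2) => A; exact: dist_L.
pose Ll2 : l2 := f1 - mk_l2 gP.
have Ll2E x : Ll2 x = L x by rewrite l2DE l2NE /l2_fun/= subKr.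
apply/cvg_ex; exists Ll2; apply/cvgrPdist_lt => e e0.
have e4 : 0 < e / 4 by rewrite divr_gt0.
have [f0 Ff0] := Fx _ e4.
apply: filterS (Ff0) => f; rewrite -ball_normE/= => f0f.
have f0L : `|Ll2 - f0| <= 2 * (e / 4).
  rewrite distrC; apply/l2_norm_le => [|A]; first by rewrite mulr_ge0// ltW.
  have := dist_L _ _ e4 Ff0 A; congr (fsum _ _ <= _).
  by apply/funext => x; rewrite -Ll2E.
have -> : Ll2 - f = (Ll2 - f0) + (f0 - f) by rewrite addrA subrK.
apply: (le_lt_trans (ler_normD _ _)).
apply: (lt_le_trans (ler_ltD f0L f0f)).
have -> : 2 * (e / 4) + e / 4 = e - e / 4 by field.
by rewrite gerBl ltW.
Qed.

HB.instance Definition _ := Uniform_isComplete.Build l2 l2_complete.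
HB.instance Definition _ :=
  NormedModule_isHilbert.Build R l2 l2_ip_inner l2_norm_sqr.

End SquareSummable.

(** * The C*-algebra of bounded operators on a Hilbert space *)

Section BoundedOperators.
Variables (R : realType) (H : hilbertType R).
Implicit Types (T S : H -> H) (x y z : H) (M : R[i]).

Lemma ip_le x y : `|ip x y| <= `|x| * `|y|.
Proof.
by have := cauchy_schwarz_sqrt ip_inner x y; rewrite !ip_norm !sqrCK.
Qed.

Definition adjoint T S : Prop := forall x y, ip (T x) y = ip x (S y).

Definition bounded_by T M : Prop := 0 <= M /\ forall x, `|T x| <= M * `|x|.

(** Linearity follows from the existence of an adjoint ([adjoint_linear]). *)
Definition adjointable : {pred H -> H} := fun T =>
  `[< (exists S, adjoint T S) /\ exists M, bounded_by T M >].

Lemma adjoint_sym T S : adjoint T S -> adjoint S T.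
Proof.
by move=> TS x y; rewrite (ip_conj ip_inner y) (ip_conj ip_inner _ x) TS.
Qed.

Lemma adjoint_lin c T S T' S' : adjoint T S -> adjoint T' S' ->
  adjoint (c *: T + T') (c^* *: S + S').
Proof.
move=> TS TS' x y; rewrite (ip_linearl ip_inner) (ipDr ip_inner).
by rewrite (ipZr ip_inner) conjCK TS TS'.
Qed.

Lemma adjoint_linear T S : adjoint T S -> linear T.
Proof.
move=> TS c x y; apply: (ip_ext ip_inner) => z.
by rewrite TS !(ip_linearl ip_inner) !TS.
Qed.

Lemma adjoint_unique T S S' : adjoint T S -> adjoint T S' -> S = S'.
Proof.
move=> TS TS'; apply/funext => y; apply: (ip_sym_ext ip_inner) => z.
by rewrite -TS TS'.
Qed.

(** From |S y|^2 = <T (S y), y> <= M |S y| |y|. *)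
Lemma adjoint_bounded T S M : adjoint T S -> bounded_by T M -> bounded_by S M.
Proof.
move=> TS [M0 TM]; split=> // y; have [->|Sy0] := eqVneq (S y) 0.
  by rewrite normr0 mulr_ge0.
have Sy_gt0 : 0 < `|S y| by rewrite normr_gt0.
rewrite -(ler_pM2l Sy_gt0) -expr2 -ip_norm -TS.
rewrite (le_trans (real_ler_norm _))//.
  by rewrite TS ip_norm realX.
by rewrite (le_trans (ip_le _ _))// mulrCA mulrA ler_wpM2r.
Qed.

Lemma adjointable_submod : submod_closed adjointable.
Proof.
split=> [|c T T' /asboolP[[S TS] [M [M0 TM]]]
    /asboolP[[S' TS'] [M' [M'0 TM']]]].
  apply/asboolP; split.
    by exists 0 => x y; rewrite (ip0l ip_inner) (ip0r ip_inner).
  by exists 0; split=> // x; rewrite normr0 mul0r.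
apply/asboolP; split; first by eexists; exact: adjoint_lin.
exists (`|c| * M + M'); split=> [|x]; first by rewrite addr_ge0 ?mulr_ge0.
rewrite (le_trans (ler_normD _ _))// mulrDl lerD//.
by rewrite normrZ -mulrA ler_wpM2l.
Qed.

HB.instance Definition _ :=
  GRing.isSubmodClosed.Build R[i] (H -> H) adjointable adjointable_submod.

Definition bop : Type := {T : H -> H | T \in adjointable}.
HB.instance Definition _ := SubChoice.on bop.
HB.instance Definition _ := [SubChoice_isSubLmodule of bop by <:].

Definition bop_fun (a : bop) : H -> H := val a.
Coercion bop_fun : bop >-> Funclass.
Implicit Types a b : bop.

Lemma mk_bop_subproof T S M : adjoint T S -> bounded_by T M ->
  T \in adjointable.
Proof. by move=> TS TM; apply/asboolP; split; [exists S|exists M]. Qed.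

Definition mk_bop T S M (TS : adjoint T S) (TM : bounded_by T M) : bop :=
  exist (fun T => T \in adjointable) T (mk_bop_subproof TS TM).

Lemma bop_ext a b : (forall x, a x = b x) -> a = b.
Proof. by move=> ab; apply/val_inj/funext. Qed.

Lemma bop_has_adjoint a : exists S, adjoint a S.
Proof. by have /asboolP[] := valP a. Qed.

Definition bop_adj a : H -> H := sval (cid (bop_has_adjoint a)).

Lemma bop_adjP a : adjoint a (bop_adj a).
Proof. exact: svalP (cid (bop_has_adjoint a)). Qed.

Lemma bop_adjE a S : adjoint a S -> bop_adj a = S.
Proof. exact: adjoint_unique (@bop_adjP a). Qed.

Lemma bop_linear a : linear a.
Proof. exact: adjoint_linear (@bop_adjP a). Qed.

Definition bop_norm a : R[i] := (inf [set M | bounded_by a M%:C%C])%:C%C.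

Lemma bop_norm_le a M : bounded_by a M -> bop_norm a <= M.
Proof.
move=> aM; have M_real : M = (complex.Re M)%:C%C.
  by rewrite RRe_real// ger0_real// aM.1.
rewrite M_real lecR; apply: ge_inf; last by rewrite /= -M_real.
by exists 0 => r [+ _]; rewrite lecR.
Qed.

Lemma bop_normP a : bounded_by a (bop_norm a).
Proof.
have /asboolP[_ [M aM]] := valP a.
have M_real : M = (complex.Re M)%:C%C by rewrite RRe_real// ger0_real// aM.1.
have ne : [set M | bounded_by a M%:C%C] !=set0.
  by exists (complex.Re M); rewrite /= -M_real.
split=> [|x].
  by rewrite lecR; apply: lb_le_inf => // r [+ _]; rewrite lecR.
have [->|x0] := eqVneq x 0.
  by have [_ /(_ 0)] := aM; rewrite normr0 !mulr0.
have xgt0 : 0 < `|x| by rewrite normr_gt0.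
rewrite -ler_pdivrMr//.
have q_real : `|a x| / `|x| = (complex.Re (`|a x| / `|x|))%:C%C.
  by rewrite RRe_real// ger0_real// divr_ge0.
rewrite q_real lecR; apply: lb_le_inf => // r [_ /(_ x)].
by rewrite -ler_pdivrMr// q_real lecR.
Qed.

Lemma bop_norm_ge0 a : 0 <= bop_norm a.
Proof. exact: (bop_normP a).1. Qed.

Lemma bop_apply_le a x : `|a x| <= bop_norm a * `|x|.
Proof. exact: (bop_normP a).2. Qed.

Lemma bop_normD a b : bop_norm (a + b) <= bop_norm a + bop_norm b.
Proof.
apply: bop_norm_le; split=> [|x]; first by rewrite addr_ge0 ?bop_norm_ge0.
by rewrite (le_trans (ler_normD _ _))// mulrDl lerD ?bop_apply_le.
Qed.

Lemma bop_normZ (c : R[i]) a : bop_norm (c *: a) = `|c| * bop_norm a.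
Proof.
have leZ (d : R[i]) b : bop_norm (d *: b) <= `|d| * bop_norm b.
  apply: bop_norm_le; split=> [|x]; first by rewrite mulr_ge0 ?bop_norm_ge0.
  by rewrite [X in `|X|]/= normrZ -mulrA ler_wpM2l ?bop_apply_le.
apply/le_anti; rewrite leZ/=; have [->|c0] := eqVneq c 0.
  by rewrite normr0 mul0r bop_norm_ge0.
rewrite -ler_pdivlMl ?normr_gt0// -normfV.
by have := leZ c^-1 (c *: a); rewrite scalerA mulVf// scale1r.
Qed.

Lemma bop_norm0_eq0 a : bop_norm a = 0 -> a = 0.
Proof.
move=> a0; apply: bop_ext => x; apply/normr0_eq0/le_anti.
by rewrite normr_ge0 andbT (le_trans (bop_apply_le _ _))// a0 mul0r.
Qed.

HB.instance Definition _ :=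
  Lmodule_isNormed.Build R[i] bop bop_normD bop_normZ bop_norm0_eq0.

Lemma bop_le a x : `|a x| <= `|a| * `|x|.
Proof. exact: bop_apply_le. Qed.

Lemma norm_bop_le a M : bounded_by a M -> `|a| <= M.
Proof. exact: bop_norm_le. Qed.

Lemma bounded_norm a : bounded_by a `|a|.
Proof. exact: bop_normP. Qed.

Lemma bounded_comp T S M N :
  bounded_by T M -> bounded_by S N -> bounded_by (T \o S) (M * N).
Proof.
move=> [M0 TM] [N0 SN]; split=> [|x]; first by rewrite mulr_ge0.
by rewrite (le_trans (TM _))// -mulrA ler_wpM2l.
Qed.

Lemma adjoint_id : adjoint id id.
Proof. by []. Qed.

Lemma bounded_id : bounded_by id 1.
Proof. by split=> // x; rewrite mul1r. Qed.

Lemma adjoint_comp T S T' S' :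
  adjoint T S -> adjoint T' S' -> adjoint (T \o T') (S' \o S).
Proof. by move=> TS TS' x y; rewrite /= TS TS'. Qed.

Definition bop_one : bop := mk_bop adjoint_id bounded_id.

Definition bop_mul a b : bop :=
  mk_bop (adjoint_comp (@bop_adjP a) (@bop_adjP b))
    (bounded_comp (bounded_norm a) (bounded_norm b)).

Definition bop_star a : bop :=
  mk_bop (adjoint_sym (@bop_adjP a))
    (adjoint_bounded (@bop_adjP a) (bounded_norm a)).

Lemma bop_starP a : adjoint a (bop_star a).
Proof. exact: bop_adjP. Qed.

Lemma bop_starE a b : adjoint a b -> bop_star a = b.
Proof. by move=> ab; apply: bop_ext => x; rewrite -(bop_adjE ab). Qed.

Lemma bop_mulA : associative bop_mul.
Proof. by move=> a b c; apply: bop_ext. Qed.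

Lemma bop_mul1x : left_id bop_one bop_mul.
Proof. by move=> a; apply: bop_ext. Qed.

Lemma bop_mulx1 : right_id bop_one bop_mul.
Proof. by move=> a; apply: bop_ext. Qed.

Lemma bop_mulDl : left_distributive bop_mul +%R.
Proof. by move=> a b c; apply: bop_ext. Qed.

Lemma bop_addE a b x : (a + b : bop) x = a x + b x. Proof. by []. Qed.

Lemma bop_scaleE (c : R[i]) a x : (c *: a : bop) x = c *: a x.
Proof. by []. Qed.

Lemma bop_mulE a b x : bop_mul a b x = a (b x). Proof. by []. Qed.

Lemma bop_applyD a x y : a (x + y) = a x + a y.
Proof. by have := bop_linear a 1 x y; rewrite !scale1r. Qed.

Lemma bop_apply0 a : a 0 = 0.
Proof. by apply: (addrI (a 0)); rewrite -bop_applyD !addr0. Qed.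

Lemma bop_applyZ a (c : R[i]) x : a (c *: x) = c *: a x.
Proof. by have := bop_linear a c x 0; rewrite bop_apply0 !addr0. Qed.

Lemma bop_mulDr : right_distributive bop_mul +%R.
Proof. by move=> a b c; apply: bop_ext => x; exact: bop_applyD. Qed.

Lemma bop_mulZl (c : R[i]) a b : bop_mul (c *: a) b = c *: bop_mul a b.
Proof. exact: bop_ext. Qed.

Lemma bop_mulZr (c : R[i]) a b : bop_mul a (c *: b) = c *: bop_mul a b.
Proof. by apply: bop_ext => x; rewrite bop_mulE !bop_scaleE bop_applyZ. Qed.

Lemma bop_starK : involutive bop_star.
Proof. by move=> a; apply: bop_starE; exact/adjoint_sym/bop_starP. Qed.

Lemma bop_starD : {morph bop_star : a b / a + b}.
Proof.
move=> a b; apply: bop_starE => x y.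
by rewrite !bop_addE (ipDl ip_inner) (ipDr ip_inner) !bop_starP.
Qed.

Lemma bop_starZ (c : R[i]) a : bop_star (c *: a) = c^* *: bop_star a.
Proof.
apply: bop_starE => x y; rewrite [X in ip X]/= [X in ip _ X]/=.
by rewrite (ipZl ip_inner) (ipZr ip_inner) conjCK bop_starP.
Qed.

Lemma bop_starM a b :
  bop_star (bop_mul a b) = bop_mul (bop_star b) (bop_star a).
Proof. by apply: bop_starE; apply: adjoint_comp; exact: bop_starP. Qed.

Lemma bop_norm_mul a b : `|bop_mul a b| <= `|a| * `|b|.
Proof.
by apply: norm_bop_le; apply: bounded_comp; exact: bounded_norm.
Qed.

Lemma bop_norm_star_le a : `|bop_star a| <= `|a|.
Proof.
apply: norm_bop_le; apply: (adjoint_bounded (@bop_starP a)).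
exact: bounded_norm.
Qed.

(** From |a x|^2 = <x, a* a x> <= |a* a| |x|^2. *)
Lemma bop_norm_star_mul a : `|bop_mul (bop_star a) a| = `|a| ^+ 2.
Proof.
apply/le_anti/andP; split.
  by rewrite (le_trans (bop_norm_mul _ _))// expr2 ler_wpM2r// bop_norm_star_le.
set N := `|bop_mul _ _|; have N0 : 0 <= N by exact: normr_ge0.
rewrite -[N]sqrtCK ler_pXn2r ?nnegrE ?sqrtC_ge0//.
apply: norm_bop_le; split=> [|x]; first by rewrite sqrtC_ge0.
rewrite -(@ler_pXn2r _ 2) ?nnegrE ?mulr_ge0 ?sqrtC_ge0// exprMn sqrtCK.
rewrite -ip_norm bop_starP (le_trans (real_ler_norm _))//.
  by rewrite -bop_starP ip_norm realX.
rewrite (le_trans (ip_le _ _))// [leLHS]mulrC expr2 mulrA ler_wpM2r//.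
exact: (bop_le (bop_mul (bop_star a) a) x).
Qed.

(** Both [a x] and [a^* x] converge along the filter, because taking
    adjoints does not increase the norm ([bop_norm_star_le]); the pointwise
    limits are adjoint to each other, so the limit is again an operator. *)
Lemma bop_complete (F : set_system bop) : ProperFilter F -> cauchy F -> cvg F.
Proof.
move=> FF /cauchyP Fc.
have Fx e : 0 < e -> exists a : bop, F (ball a e) by exact: Fc.
have pt_cvg (f : bop -> bop) x : (forall a b, `|f a - f b| <= `|a - b|) ->
    cvg ((fun a : bop => f a x) @ F).
  move=> f_le; apply/cauchy_cvgP/cauchyP => e e0.
  have e0' : 0 < e / (`|x| + 1) by rewrite divr_gt0// ltr_wpDl.
  have [a Fa] := Fx _ e0'; exists (f a x); rewrite /fmap/=.
  apply: (filterS _ Fa) => b; rewrite -!ball_normE/= => ab.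
  apply: (le_lt_trans (bop_le (f a - f b) x)).
  rewrite (le_lt_trans (ler_wpM2r _ (f_le a b)))//.
  rewrite ltr_pdivlMr ?ltr_wpDl// in ab; apply: le_lt_trans ab.
  by rewrite ler_wpM2l// lerDl.
have a_cvg x : cvg ((fun a : bop => a x) @ F) by exact: (pt_cvg id).
have s_cvg x : cvg ((fun a : bop => bop_star a x) @ F).
  apply: pt_cvg => a b; suff -> : bop_star a - bop_star b = bop_star (a - b).
    exact: bop_norm_star_le.
  rewrite bop_starD -[- b]scaleN1r bop_starZ rmorphN rmorph1.
  by rewrite scaleN1r.
pose L x : H := lim ((fun a : bop => a x) @ F).
pose S x : H := lim ((fun a : bop => bop_star a x) @ F).
have LS : adjoint L S.
  move=> x y; apply/subr0_eq/normr0_eq0/le_anti; rewrite normr_ge0 andbT.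
  apply/ler_addgt0Pr => e e0; rewrite add0r.
  pose d := e / (`|x| + `|y| + 1).
  have d0 : 0 < d by rewrite divr_gt0// ltr_wpDl// addr_ge0.
  have /cvgrPdist_lt/(_ _ d0) Fa := a_cvg x.
  have /cvgrPdist_lt/(_ _ d0) Fs := s_cvg y.
  have [a [/ltW aL /ltW aS]] := @filter_ex _ F FF _ (filterI Fa Fs).
  have -> : ip (L x) y - ip x (S y) =
      ip (L x - a x) y - ip x (S y - bop_star a y).
    rewrite (ipBl ip_inner) (ipBr ip_inner) (bop_starP a).
    by rewrite opprB addrA subrK.
  rewrite (le_trans (ler_normB _ _))//.
  rewrite (@le_trans _ _ (d * `|y| + d * `|x|))//.
    rewrite lerD// (le_trans (ip_le _ _))//; first by rewrite ler_wpM2r.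
    by rewrite mulrC ler_wpM2r.
  rewrite -mulrDr (addrC (`|y|)) /d -mulrA ler_piMr ?(ltW e0)//.
  by rewrite mulrC ler_pdivrMr ?mul1r ?lerDl// ltr_wpDl// addr_ge0.
have L_near (a : bop) e : 0 < e -> F (ball a e) ->
    forall x, `|a x - L x| <= e * `|x|.
  move=> e0 Fa x; apply/ler_addgt0Pr => d d0.
  have /cvgrPdist_lt/(_ _ d0) Fd := a_cvg x.
  have [b [ab bL]] := @filter_ex _ F FF _ (filterI Fa Fd).
  have -> : a x - L x = (a - b : bop) x + (b x - L x).
    by rewrite [(a - b : bop) x]/= addrA subrK.
  rewrite (le_trans (ler_normD _ _))// lerD//; last by rewrite distrC ltW.
  by rewrite (le_trans (bop_le _ _))// ler_wpM2r// ltW.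
have [a1 Fa1] := Fx _ ltr01.
have L_bounded : bounded_by L (`|a1| + 1).
  split=> [|x]; first by rewrite addr_ge0.
  have -> : L x = a1 x - (a1 x - L x) by rewrite subKr.
  rewrite (le_trans (ler_normB _ _))// mulrDl lerD ?bop_le//.
  exact: L_near.
pose A : bop := mk_bop LS L_bounded.
apply/cvg_ex; exists A; apply/cvgrPdist_lt => e e0.
have e4 : 0 < e / 4 by rewrite divr_gt0.
have [a0 Fa0] := Fx _ e4.
apply: (filterS _ Fa0) => a; rewrite -ball_normE/= => a0a.
have a0A : `|A - a0| <= e / 4.
  rewrite distrC; apply: norm_bop_le; split=> [|x]; first exact: ltW.
  exact: L_near.
have -> : A - a = (A - a0) + (a0 - a) by rewrite addrA subrK.
apply: (le_lt_trans (ler_normD _ _)).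
apply: (lt_le_trans (ler_ltD a0A a0a)).
have -> : e / 4 + e / 4 = e - e / 2 by field.
by rewrite gerBl ltW// divr_gt0.
Qed.

HB.instance Definition _ := Uniform_isComplete.Build bop bop_complete.

HB.instance Definition _ := NormedModule_isCStarAlgebra.Build R bop
  bop_mulA bop_mul1x bop_mulx1 bop_mulDl bop_mulDr bop_mulZl bop_mulZr
  bop_starK bop_starD bop_starZ bop_starM bop_norm_mul bop_norm_star_mul.

End BoundedOperators.

(** * Isometries of l2 induced by injections *)

Section Shifts.
Variables (R : realType) (X : choiceType).
Implicit Types (phi psi : X -> X) (A B : {fset X}).

Definition pushforward phi (a : X -> R[i]) (y : X) : R[i] :=
  if pselect (range phi y) is left h then a (projT1 (cid2 h)) else 0.

Lemma pushforwardE phi a x : injective phi -> pushforward phi a (phi x) = a x.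
Proof.
move=> phi_inj; rewrite /pushforward; case: pselect => [h|[]]; last by exists x.
by case: cid2 => y _ /= /phi_inj->.
Qed.

Lemma pushforward_out phi a y : ~ range phi y -> pushforward phi a y = 0.
Proof. by rewrite /pushforward; case: pselect. Qed.

Lemma pushforward_comp phi (h : X -> R[i] -> R[i]) a y :
  (forall y, h y 0 = 0) ->
  h y (pushforward phi a y) = pushforward phi (fun x => h (phi x) (a x)) y.
Proof.
move=> h0; rewrite /pushforward; case: pselect => // yr.
by case: cid2 => x _ /= ->.
Qed.

(** The points of [B] outside the range of [phi] contribute nothing, so only
    the preimage [D] of [B] matters. *)
Lemma fsum_pushforward phi a B : injective phi ->
  exists2 D : {fset X}, (forall x, (x \in D) = (phi x \in B))
    & fsum (pushforward phi a) B = fsum a D.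
Proof.
move=> phi_inj; rewrite /fsum.
elim/fset1U_rect: B => [|y B yB [D DB IH]].
  by exists fset0 => [x|]; rewrite ?inE// !big_seq_fset0.
rewrite big_fsetU1//=; have [[x _ xy]|out] := pselect (range phi y).
  exists (x |` D)%fset => [z|]; first by rewrite !inE DB -xy (inj_eq phi_inj).
  by rewrite big_fsetU1/= ?DB ?xy// -xy pushforwardE// IH.
exists D => [x|]; last by rewrite pushforward_out// add0r IH.
by rewrite DB !inE; case: eqP => // xy; case: out; exists x.
Qed.

Lemma has_sum_pushforward phi a l : injective phi ->
  has_sum a l -> has_sum (pushforward phi a) l.
Proof.
move=> phi_inj al e /al[A lA]; exists (phi @` A)%fset => B AB.
have [D DB ->] := fsum_pushforward a B phi_inj; apply: lA.
apply/fsubsetP => x xA; rewrite DB; apply: (fsubsetP AB).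
exact: in_imfset.
Qed.

Lemma pushforward_sqr phi (f : l2 R X) (B : {fset X}) : injective phi ->
  fsum (fun y => `|pushforward phi f y| ^+ 2) B <= `|f| ^+ 2.
Proof.
move=> phi_inj.
rewrite (_ : (fun _ => _) = pushforward phi (fun x => `|f x| ^+ 2)).
  have [D _ ->] := fsum_pushforward (fun x => `|f x| ^+ 2) B phi_inj.
  exact: (l2_norm_le f (normr_ge0 f)).1.
apply/funext => y; apply: (@pushforward_comp _ (fun _ z => `|z| ^+ 2)) => _.
by rewrite normr0 expr0n.
Qed.

Lemma pullback_sqr phi (f : l2 R X) (A : {fset X}) : injective phi ->
  fsum (fun x => `|f (phi x)| ^+ 2) A <= `|f| ^+ 2.
Proof.
move=> phi_inj.
have := (l2_norm_le f (normr_ge0 f)).1 (lexx _) (phi @` A)%fset.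
by rewrite /fsum big_imfset//= => x y _ _ /phi_inj.
Qed.

Lemma l2_push_subproof phi (f : l2 R X) : injective phi ->
  (pushforward phi f : X -> R[i]^o) \in @square_summable R X.
Proof.
move=> phi_inj; apply/square_summableP; exists (`|f| ^+ 2) => A.
exact: pushforward_sqr.
Qed.

Lemma l2_pull_subproof phi (f : l2 R X) : injective phi ->
  ((fun x => f (phi x)) : X -> R[i]^o) \in @square_summable R X.
Proof.
move=> phi_inj; apply/square_summableP; exists (`|f| ^+ 2) => A.
exact: pullback_sqr.
Qed.

(** Fixes the type of [a f] as a function on [X], so that matrix coefficients
    can be written [act a f x]. *)
Definition act (a : bop (l2 R X)) (f : l2 R X) : l2 R X := a f.

Section Shift.
Variables (phi : X -> X) (phi_inj : injective phi).

Definition l2_push (f : l2 R X) : l2 R X := mk_l2 (l2_push_subproof f phi_inj).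
Definition l2_pull (f : l2 R X) : l2 R X := mk_l2 (l2_pull_subproof f phi_inj).

Lemma l2_ip_push (f g : l2 R X) : l2_ip (l2_push f) g = l2_ip f (l2_pull g).
Proof.
apply: infsumE.
have := has_sum_pushforward phi_inj (l2_ip_has_sum f (l2_pull g)).
congr (has_sum _ _); apply/funext => y; apply/esym.
apply: (@pushforward_comp phi (fun y z => z * (g y)^*)) => z.
by rewrite mul0r.
Qed.

Lemma l2_push_adjoint : @adjoint R (l2 R X) l2_push l2_pull.
Proof. exact: l2_ip_push. Qed.

Lemma l2_push_bounded : @bounded_by R (l2 R X) l2_push 1.
Proof.
split=> // f; rewrite mul1r; apply/l2_norm_le => // A.
exact: pushforward_sqr.
Qed.

(** The isometry that sends [delta x] to [delta (phi x)]; its adjoint is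
    composition with [phi]. *)
Definition l2_shift : bop (l2 R X) := mk_bop l2_push_adjoint l2_push_bounded.

Lemma l2_shiftE (f : l2 R X) x : act l2_shift f (phi x) = f x.
Proof. exact: pushforwardE. Qed.

Lemma l2_shift_out (f : l2 R X) y : ~ range phi y -> act l2_shift f y = 0.
Proof. exact: pushforward_out. Qed.

Lemma star_shiftE (f : l2 R X) x : act (star l2_shift) f x = f (phi x).
Proof.
suff -> : act (star l2_shift) f = l2_pull f by [].
by rewrite -(@bop_adjE _ _ l2_shift _ l2_push_adjoint).
Qed.

End Shift.

Lemma act_ext (a b : bop (l2 R X)) :
  (forall f x, act a f x = act b f x) -> a = b.
Proof. by move=> ab; apply: bop_ext => f; apply: l2_ext. Qed.

Lemma actM (a b : bop (l2 R X)) (f : l2 R X) : act (a ** b) f = act a (act b f).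
Proof. by []. Qed.

Lemma act1 (f : l2 R X) : act cone f = f.
Proof. by []. Qed.

Lemma act0 (f : l2 R X) x : act 0 f x = 0.
Proof. by []. Qed.

Lemma actZ (c : R[i]) (a : bop (l2 R X)) (f : l2 R X) x :
  act (c *: a) f x = c * act a f x.
Proof. by rewrite /act bop_scaleE l2ZE. Qed.

Lemma actD (a b : bop (l2 R X)) (f : l2 R X) x :
  act (a + b) f x = act a f x + act b f x.
Proof. by rewrite /act bop_addE l2DE. Qed.

Lemma act_sum (I : Type) (r : seq I) (a : I -> bop (l2 R X)) (f : l2 R X) x :
  act (\sum_(i <- r) a i) f x = \sum_(i <- r) act (a i) f x.
Proof. apply: (big_morph (fun b => act b f x)); last exact: act0.
by move=> b c; exact: actD. Qed.

Lemma l2_shift_isometry phi (phi_inj : injective phi) :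
  star (l2_shift phi_inj) ** l2_shift phi_inj = cone.
Proof. by apply: act_ext => f x; rewrite actM star_shiftE l2_shiftE. Qed.

Lemma l2_shift_mul phi psi chi
    (phi_inj : injective phi) (psi_inj : injective psi)
    (chi_inj : injective chi) : (forall x, chi x = phi (psi x)) ->
  l2_shift phi_inj ** l2_shift psi_inj = l2_shift chi_inj.
Proof.
move=> chiE; apply: act_ext => f z; rewrite actM.
have [[y _ <-]|out] := pselect (range phi z); last first.
  rewrite !l2_shift_out// => -[x _ xz]; apply: out.
  by exists (psi x); rewrite -?chiE.
rewrite l2_shiftE; have [[x _ <-]|out] := pselect (range psi y).
  by rewrite l2_shiftE -chiE l2_shiftE.
rewrite !l2_shift_out// => -[x _ xy]; apply: out; exists x => //.
by apply: phi_inj; rewrite -chiE.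
Qed.

Lemma l2_shift_id phi (phi_inj : injective phi) : phi =1 id ->
  l2_shift phi_inj = cone.
Proof.
move=> phiE; apply: act_ext => f x.
by rewrite act1 -[in LHS](phiE x) l2_shiftE.
Qed.

Lemma delta_subproof (x : X) :
  ((fun y => (x == y)%:R) : X -> R[i]^o) \in @square_summable R X.
Proof.
apply/square_summableP; exists 1 => A; rewrite /fsum.
have [xA|xA] := boolP (x \in A).
  rewrite (big_fsetD1 x)//= eqxx normr1 expr1n big_seq big1 ?addr0// => y.
  by rewrite !inE eq_sym => /andP[/negPf-> _]; rewrite normr0 expr0n.
rewrite big_seq big1 ?ler01// => y yA; case: eqP => [xy|_].
  by rewrite xy yA in xA.
by rewrite normr0 expr0n.
Qed.

Definition delta (x : X) : l2 R X := mk_l2 (delta_subproof x).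

Lemma deltaE x y : delta x y = (x == y)%:R.
Proof. by []. Qed.

Lemma l2_shift_delta phi (phi_inj : injective phi) x :
  act (l2_shift phi_inj) (delta x) = delta (phi x).
Proof.
apply: l2_ext => y; have [[z _ <-]|out] := pselect (range phi y).
  by rewrite l2_shiftE !deltaE (inj_eq phi_inj).
by rewrite l2_shift_out// deltaE; case: eqP => // xy; case: out; exists x.
Qed.

End Shifts.

(** * The regular representation of the boundary quotient *)

Section RegularRepresentation.
Variables (R : realType) (G : groupType) (P : monoidType) (theta : P -> G -> G).
Hypothesis ads : algebraic_dynamical_system theta.
Hypothesis abelian : abelian_monoid P.

Lemma theta1 p : theta p 1%g = 1%g.
Proof. by apply: (mulgI (theta p 1%g)); rewrite -(ads_endo ads) !mulg1. Qed.

Lemma thetaV p g : theta p g^-1%g = (theta p g)^-1%g.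
Proof.
by apply: (mulgI (theta p g)); rewrite -(ads_endo ads) !mulgV theta1.
Qed.

Definition regular_u g : bop (l2 R G) := l2_shift R (@mulgI _ g).
Definition regular_s p : bop (l2 R G) := l2_shift R (@ads_inj _ _ _ ads p).

Lemma regular_uE g (f : l2 R G) x : act (regular_u g) f x = f (g^-1 * x)%g.
Proof. by rewrite -{1}(mulVKg g x) l2_shiftE. Qed.

Lemma regular_uVE g (f : l2 R G) x :
  act (star (regular_u g)) f x = f (g * x)%g.
Proof. exact: star_shiftE. Qed.

Lemma regular_sE p (f : l2 R G) x : act (regular_s p) f (theta p x) = f x.
Proof. exact: l2_shiftE. Qed.

Lemma regular_s_out p (f : l2 R G) x :
  ~ range (theta p) x -> act (regular_s p) f x = 0.
Proof. exact: l2_shift_out. Qed.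

Lemma regular_sVE p (f : l2 R G) x :
  act (star (regular_s p)) f x = f (theta p x).
Proof. exact: star_shiftE. Qed.

(** The product [p * q] lies in both ideals, so they cannot be disjoint. *)
Lemma abelian_LCM (p q : P) : exists p' q',
  right_ideal p `&` right_ideal q = right_ideal (p * p')%g /\
  (p * p' = q * q')%g.
Proof.
have [_ _ /(_ p q)[pq0|[r pqr]]] := ads_right_LCM ads.
  have : (right_ideal p `&` right_ideal q) (p * q)%g.
    by split; [exists q|exists p; rewrite abelian].
  by rewrite pq0.
have : right_ideal r r by exists 1%g; rewrite mulg1.
by rewrite -pqr => -[[p' rp] [q' rq]]; exists p', q'; rewrite -rp -rq.
Qed.

(** Both sides, evaluated at [x], involve a solution [y] of
    [theta_p (g1^-1 x) = theta_q (g2 y)]; as the ranges of [theta_p] and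
    [theta_q] meet in that of [theta_(p p')], it is solvable exactly when
    [g1^-1 x] is in the range of [theta_p']. *)
Lemma regular_product p q g g1 g2 p' q' :
  factorization theta p q g g1 g2 p' q' ->
  star (regular_s p) ** regular_u g ** regular_s q =
  regular_u g1 ** regular_s p' ** star (regular_s q') ** regular_u g2.
Proof.
move=> [gE pq_ideal pqE]; apply: act_ext => f x.
rewrite !actM regular_sVE !regular_uE.
have range_pq := ads_order ads pq_ideal.
have [[y _ yE]|out] := pselect (range (theta p') (g1^-1 * x)%g).
  rewrite -yE regular_sE regular_sVE regular_uE.
  rewrite gE -[x in LHS](mulVKg g1) -yE (ads_endo ads) invgM -!mulgA mulKg.
  rewrite -(ads_actM ads) pqE (ads_actM ads) -thetaV -(ads_endo ads).
  by rewrite regular_sE.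
rewrite [RHS]regular_s_out// regular_s_out// => -[y _ yE]; apply: out.
have : (range (theta p) `&` range (theta q)) (theta p (g1^-1 * x)%g).
  split; first by exists (g1^-1 * x)%g.
  exists (g2 * y)%g => //; rewrite !(ads_endo ads) yE gE thetaV.
  by rewrite invgM -!mulgA mulVKg.
rewrite range_pq => -[z _]; rewrite (ads_actM ads) => /(ads_inj ads) zE.
by exists z.
Qed.

(** If the operator did not vanish at [x], some [y] would satisfy
    [theta_p x = g theta_q y], which is a factorization of [g]. *)
Lemma regular_product0 p q g :
  ~ (exists g1 g2 p' q', factorization theta p q g g1 g2 p' q') ->
  star (regular_s p) ** regular_u g ** regular_s q = 0.
Proof.
move=> nofact; apply: act_ext => f x; rewrite !actM regular_sVE regular_uE act0.
apply: regular_s_out => -[y _ yE]; apply: nofact.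
have [p' [q' [pq_ideal pqE]]] := abelian_LCM p q.
exists x, y^-1%g, p', q'; split=> //.
by rewrite thetaV yE invgM invgK mulVKg.
Qed.

Lemma regular_projection p g (f : l2 R G) x :
  act (regular_u g ** regular_s p ** star (regular_s p) ** star (regular_u g))
    f x = if pselect (coset theta p g x) then f x else 0.
Proof.
rewrite !actM regular_uE; case: pselect => [xg|out] /=.
  case: xg => k ->; rewrite mulKg regular_sE regular_sVE.
  by rewrite regular_uVE.
rewrite regular_s_out// => -[k _ kE]; apply: out.
by exists k; rewrite kE mulVKg.
Qed.

Lemma coset_eq p g x : coset theta p g x -> coset theta p x = coset theta p g.
Proof.
move=> [k ->]; apply/seteqP; split=> y [m ->].
  by exists (k * m)%g; rewrite (ads_endo ads) mulgA.
exists (k^-1 * m)%g; rewrite (ads_endo ads) thetaV -!mulgA.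
by rewrite mulVKg.
Qed.

Lemma regular_partition p : finite_set (cosets theta p) ->
  \sum_(c \in cosets theta p)
    (let g := xget 1%g c in regular_u g ** regular_s p ** star (regular_s p)
       ** star (regular_u g)) = cone.
Proof.
move=> fin; apply: act_ext => f x; rewrite act1.
have coset_rep c : cosets theta p c -> coset theta p (xget 1%g c) = c.
  move=> [h _ <-]; apply: coset_eq; case: xgetP => // /(_ h) [].
  by exists 1%g; rewrite theta1 mulg1.
have x_coset : coset theta p x \in fset_set (cosets theta p).
  by rewrite in_fset_set// inE; exists x.
rewrite fsbig_finite// act_sum (big_fsetD1 _ x_coset)/=.
rewrite regular_projection coset_rep; last by exists x.
case: pselect => [xx|[]] /=; last by exists 1%g; rewrite theta1 mulg1.
rewrite big_seq big1 ?addr0// => c; rewrite in_fsetD1 in_fset_set//.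
move=> /andP[/eqP c_neq /set_mem c_coset].
rewrite regular_projection coset_rep//.
case: pselect => // xc; case: c_neq; rewrite -(coset_rep c)//.
by apply/esym/coset_eq; rewrite coset_rep.
Qed.

Lemma regular_representation :
  boundary_representation theta regular_u regular_s.
Proof.
split.
- move=> g; split; first exact: l2_shift_isometry.
  by apply: act_ext => f x; rewrite actM regular_uE regular_uVE mulVKg.
- by apply: l2_shift_id => x; rewrite mul1g.
- by move=> g h; apply/esym/l2_shift_mul => x; rewrite mulgA.
- by move=> p; exact: l2_shift_isometry.
- by apply: l2_shift_id => x; rewrite (ads_act1 ads).
- by move=> p q; apply/esym/l2_shift_mul => x; rewrite (ads_actM ads).
- move=> p g; have inj : injective (fun x => theta p (g * x)%g).
    by move=> x y /(ads_inj ads)/mulgI.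
  rewrite /regular_s /regular_u (l2_shift_mul _ _ _ inj)//.
  by apply/esym/l2_shift_mul => x; rewrite (ads_endo ads).
- exact: regular_product.
- exact: regular_product0.
- exact: regular_partition.
Qed.

End RegularRepresentation.

(** * Outerness *)

Lemma dual_trivial (R : realType) (P : monoidType) (K : groupType) (i : P -> K)
    (chi : dual R K) : grothendieck_group i ->
  (forall p, chi (i p) = 1) -> chi = 1%g.
Proof.
move=> [_ _ _ fraction _] chi1; apply: dual_eq => k.
have [_ chiM] := dualP chi.
have [p [q ->]] := fraction k; rewrite [RHS]/=.
have := chiM (i p) ((i p)^-1 * i q)%g.
by rewrite mulVKg !chi1 mul1r => <-.
Qed.

(** If [W] is the image of [w] in the regular representation, then the vector
    [xi = W (delta 1)] is fixed by every [c p *: s_p], which confines its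
    support to the intersection of the [theta_p(G)]. *)
Lemma isometry_scaling_trivial (R : realType) (G : groupType) (P : monoidType)
    (theta : P -> G -> G) (Q : cstarAlgType R) (u : G -> Q) (s : P -> Q)
    (c : P -> R[i]) (w : Q) :
  algebraic_dynamical_system theta ->
  abelian_monoid P ->
  \bigcap_(p in [set: P]) range (theta p) = [set 1%g] ->
  boundary_quotient theta u s ->
  star w ** w = cone ->
  (forall p, w ** s p = c p *: (s p ** w)) ->
  forall p, c p = 1.
Proof.
move=> ads abelian trivial_cap [_ _ universal] wVw scaling p0.
have [phi [[phi_lin phiM phi1 _] _ phi_s]] :=
  universal _ _ _ (@regular_representation R G P theta ads abelian).
pose W := phi w; pose xi := act W (delta R 1%g).
have phiZ (a : R[i]) x : phi (a *: x) = a *: phi x.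
  have phi0 : phi 0 = 0.
    apply: (addrI (phi 0)); rewrite addr0.
    by have := phi_lin 1 0 0; rewrite !scale1r addr0.
  by have := phi_lin a x 0; rewrite phi0 !addr0.
have W_scaling p : W ** regular_s R ads p = c p *: (regular_s R ads p ** W).
  by rewrite -phi_s -!phiM -phiZ scaling.
have xiE p x : xi x = c p * act (regular_s R ads p) xi x.
  rewrite -[in RHS]actM -actZ -W_scaling actM l2_shift_delta.
  by rewrite (theta1 ads).
have xi_out x : x <> 1%g -> xi x = 0.
  move=> x1; have [p xp] : exists p, ~ range (theta p) x.
    apply: contrapT => /forallNP allp; apply: x1.
    have : (\bigcap_(p in [set: P]) range (theta p)) x.
      by move=> p _; exact: contrapT (allp p).
    by rewrite trivial_cap.
  by rewrite (xiE p) regular_s_out// mulr0.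
have xi1_neq0 : xi 1%g != 0.
  apply/eqP => xi1; have xi0 : xi = 0.
    apply: l2_ext => x; rewrite l20E.
    by have [->|/eqP/xi_out] := eqVneq x 1%g.
  have := congr1 (fun a => act a (delta R 1%g) 1%g) phi1.
  rewrite -wVw phiM actM -/W -/xi xi0 act1 deltaE eqxx.
  by rewrite /act bop_apply0 l20E => /esym/eqP; rewrite oner_eq0.
apply: (mulIf xi1_neq0).
by rewrite mul1r [RHS](xiE p0) -[in RHS](theta1 ads p0) regular_sE.
Qed.

Theorem corollary6p17 (R : realType) (G : groupType) (P : monoidType)
    (theta : P -> G -> G) (K : groupType) (i : P -> K)
    (Q : cstarAlgType R) (u : G -> Q) (s : P -> Q)
    (gamma : dual R K -> Q -> Q) :
  algebraic_dynamical_system theta ->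
  abelian_monoid P ->
  finite_set (invertible_elements P) ->
  \bigcap_(p in [set: P]) range (theta p) = [set 1%g] ->
  boundary_quotient theta u s ->
  grothendieck_group i ->
  gauge_action i u s gamma ->
  outer gamma.
Proof.
move=> ads abelian _ trivial_cap bq groth [_ gauge] chi chi_neq.
move=> [w [[wVw _] gammaE]]; apply: chi_neq; apply: (dual_trivial groth).
apply: (isometry_scaling_trivial ads abelian trivial_cap bq wVw) => p.
have := gauge chi 1%g p.
rewrite (br_u1 (bq_representation bq)) cmul1x gammaE /Ad.
move=> /(congr1 (fun x => x ** w)).
by rewrite -!cmulA wVw cmulx1 cmulZl.
Qed.
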